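(* A deformation of a regular oriented surface $S$ of $\mathbb{R}^3$ induces a Hamiltonian deformation of its normal congruence $\bar S$ in $T\mathbb{S}^2$. That is, if $X^\epsilon:U\to\mathbb{R}^3$ is a smooth one-parameter family of immersed oriented surfaces with unit normals $N^\epsilon$ and $\bar X^\epsilon=(N^\epsilon,\,X^\epsilon-\langle X^\epsilon,N^\epsilon\rangle N^\epsilon)$ is the corresponding family of normal congruences, then the variation field $\partial_\epsilon\bar X^\epsilon$ is Hamiltonian along $\bar X^\epsilon$.
   Context: The space of oriented lines of $(\mathbb{R}^3,\langle\cdot,\cdot\rangle)$ is identified with $T\mathbb{S}^2$ by $\{V+tp:t\in\mathbb{R}\}\simeq(p,\,V-\langle V,p\rangle p)$, where $p\in\mathbb{S}^2$ is the unit direction. The normal congruence $\bar S$ of an oriented surface $S$ parametrized by $X$ with unit normal $N$ is the surface of $T\mathbb{S}^2$ parametrized by $\bar X=(N,\,X-\langle X,N\rangle N)$. $T\mathbb{S}^2$ is viewed as $\{(N,Y)\in\mathbb{R}^3\times\mathbb{R}^3:|N|=1,\langle N,Y\rangle=0\}$. For a tangent vector $\xi=(\nu,\eta)$ at $(N,Y)$ put $P\xi=\nu$ and $K\xi=\eta-\langle\eta,N\rangle N$. The symplectic form is $\Omega(\xi,\xi')=\langle K\xi,P\xi'\rangle-\langle P\xi,K\xi'\rangle$; with $j$ the canonical complex structure of $\mathbb{S}^2$, $\mathbb{J}$ is defined by $P\mathbb{J}\xi=jP\xi$, $K\mathbb{J}\xi=jK\xi$, and $\mathbb{G}(\xi,\xi')=\Omega(\mathbb{J}\xi,\xi')$.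 Normal congruences are Lagrangian surfaces for $\Omega$. A vector field $\bar V$ along a Lagrangian immersion $\bar X:U\to T\mathbb{S}^2$ is Hamiltonian if there is a smooth function $h:U\to\mathbb{R}$ such that $\Omega(\bar V,d\bar X(\cdot))=dh$; where the metric induced by $\mathbb{G}$ is non-degenerate this is equivalent to $\bar V^\perp=\mathbb{J}Dh$, with $\bar V^\perp$ the normal part of $\bar V$ and $Dh$ the gradient of $h$ for the induced metric. A deformation of a Lagrangian surface is Hamiltonian if its variation field is Hamiltonian. *)

(* Defs.v *)
From HB Require Import structures.
From mathcomp Require Import all_boot all_order all_algebra.
From mathcomp Require Import all_classical all_reals all_analysis.

Set Implicit Arguments.
Unset Strict Implicit.
Unset Printing Implicit Defensive.

Import Order.TTheory GRing.Theory Num.Theory.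
Import numFieldNormedType.Exports.

Local Open Scope classical_set_scope.
Local Open Scope ring_scope.

(* Meaningful for A open and V finite-dimensional; being of class C^k.+1 is
   having a Frechet differential at each point of A all of whose values
   'D_v f = ('d f) v are of class C^k on A. *)
Fixpoint Ck_on (R : realType) (V W : normedModType R) (k : nat)
    (A : set V) (f : V -> W) : Prop :=
  match k with
  | 0%N => forall x, A x -> {for x, continuous f}
  | k'.+1 => (forall x, A x -> differentiable f x) /\
             (forall v : V, Ck_on k' A (fun x => 'D_v f x))
  end.

Definition smooth_on (R : realType) (V W : normedModType R)
    (A : set V) (f : V -> W) : Prop :=
  forall k : nat, Ck_on k A f.

Definition immersion_on (R : realType) (V W : normedModType R)
    (A : set V) (f : V -> W) : Prop :=
  smooth_on A f /\ forall x, A x -> injective ('d f x).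

(* The norm `|_| of 'rV_3 is the sup norm, hence a separate Euclidean norm. *)
Definition dot (R : realType) (x y : 'rV[R]_3) : R := \sum_i x 0 i * y 0 i.

Definition enorm (R : realType) (x : 'rV[R]_3) : R := Num.sqrt (dot x x).

Definition TS2 (R : realType) : set ('rV[R]_3 * 'rV[R]_3) :=
  [set z | enorm z.1 = 1 /\ dot z.1 z.2 = 0].

(* Tangent space of T S^2 at z: the kernel of the differential of
   (N, Y) |-> (<N, N>, <N, Y>). *)
Definition tangent_TS2 (R : realType) (z : 'rV[R]_3 * 'rV[R]_3) :
    set ('rV[R]_3 * 'rV[R]_3) :=
  [set xi | dot z.1 xi.1 = 0 /\ dot xi.1 z.2 + dot z.1 xi.2 = 0].

Definition P_TS2 (R : realType) (xi : 'rV[R]_3 * 'rV[R]_3) : 'rV[R]_3 := xi.1.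

Definition K_TS2 (R : realType) (z xi : 'rV[R]_3 * 'rV[R]_3) : 'rV[R]_3 :=
  xi.2 - dot xi.2 z.1 *: z.1.

Definition Omega (R : realType) (z xi xi' : 'rV[R]_3 * 'rV[R]_3) : R :=
  dot (K_TS2 z xi) (P_TS2 xi') - dot (P_TS2 xi) (K_TS2 z xi').

Definition lagrangian_immersion (R : realType) (U : set 'rV[R]_2)
    (Xbar : 'rV[R]_2 -> 'rV[R]_3 * 'rV[R]_3) : Prop :=
  [/\ forall u, U u -> TS2 (Xbar u),
      immersion_on U Xbar &
      forall u v w, U u -> Omega (Xbar u) ('d Xbar u v) ('d Xbar u w) = 0].

Definition vector_field_along (R : realType) (U : set 'rV[R]_2)
    (Xbar V : 'rV[R]_2 -> 'rV[R]_3 * 'rV[R]_3) : Prop :=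
  smooth_on U V /\ forall u, U u -> tangent_TS2 (Xbar u) (V u).

Definition hamiltonian_field (R : realType) (U : set 'rV[R]_2)
    (Xbar V : 'rV[R]_2 -> 'rV[R]_3 * 'rV[R]_3) : Prop :=
  [/\ lagrangian_immersion U Xbar,
      vector_field_along U Xbar V &
      exists h : 'rV[R]_2 -> R^o, smooth_on U h /\
        forall u v, U u -> Omega (Xbar u) (V u) ('d Xbar u v) = 'd h u v].

Definition variation_field (R : realType)
    (Xbar : R -> 'rV[R]_2 -> 'rV[R]_3 * 'rV[R]_3) (e : R)
    (u : 'rV[R]_2) : 'rV[R]_3 * 'rV[R]_3 :=
  derive1 (fun t => Xbar t u) e.

Definition smooth_family (R : realType) (W : normedModType R) (I : set R)
    (U : set 'rV[R]_2) (X : R -> 'rV[R]_2 -> W) : Prop :=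
  smooth_on (I `*` U) (fun z : R^o * 'rV[R]_2 => X z.1 z.2).

Definition hamiltonian_deformation (R : realType) (I : set R)
    (U : set 'rV[R]_2) (Xbar : R -> 'rV[R]_2 -> 'rV[R]_3 * 'rV[R]_3) : Prop :=
  smooth_family I U Xbar /\
  forall e, I e -> hamiltonian_field U (Xbar e) (variation_field Xbar e).

Definition unit_normal (R : realType) (U : set 'rV[R]_2)
    (X N : 'rV[R]_2 -> 'rV[R]_3) : Prop :=
  forall u, U u -> enorm (N u) = 1 /\ forall v, dot ('d X u v) (N u) = 0.

(* The orientations are given by a choice of unit normal that is only required
   to be continuous in (e, u); its smoothness follows from that of X. *)
Definition oriented_surface_family (R : realType) (I : set R)
    (U : set 'rV[R]_2) (X N : R -> 'rV[R]_2 -> 'rV[R]_3) : Prop :=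
  [/\ smooth_family I U X,
      forall z : R^o * 'rV[R]_2, (I `*` U) z ->
        {for z, continuous (fun z : R^o * 'rV[R]_2 => N z.1 z.2)},
      forall e, I e -> immersion_on U (X e) &
      forall e, I e -> unit_normal U (X e) (N e)].

Definition normal_congruence (R : realType) (X N : 'rV[R]_2 -> 'rV[R]_3)
    (u : 'rV[R]_2) : 'rV[R]_3 * 'rV[R]_3 :=
  (N u, X u - dot (X u) (N u) *: N u).

(* Main.v *)
(* On the parameter space of (e, u), one computes
   Omega (D_v Xbar, D_w Xbar) = <D_v X, D_w N> - <D_w X, D_v N>
   for all directions v, w. If w is tangent to the slice e = const, then
   <D_w X, N> = 0 everywhere; differentiating this along v and exchanging D_v and
   D_w (Schwarz) turns the right-hand side into D_w <D_v X, N>. For v tangent to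
   the slice it vanishes, so the congruence is Lagrangian; for v = d/de it shows
   that h = <d X / d e, N> is a Hamiltonian function of the variation field. *)
From HB Require Import structures.
Require Import Defs.
From mathcomp Require Import all_boot all_order all_algebra.
From mathcomp Require Import all_classical all_reals all_analysis.
From mathcomp Require Import ring.
Import Order.TTheory GRing.Theory Num.Theory.
Import numFieldNormedType.Exports.

Set Implicit Arguments.
Unset Strict Implicit.

Local Open Scope classical_set_scope.
Local Open Scope ring_scope.

(** * Closure properties of maps of class C^k on an open set *)

Section Ck.
Context {R : realType}.
Implicit Types V W : normedModType R.

(** The first-order expansion of [f] at [x] is also one of [g], because the little-o remainder only
    sees points near [x]; uniqueness of the differential then identifies the two. *)
Lemma near_eq_diff V W (f g : V -> W) (x : V) :
  {near x, f =1 g} -> differentiable f x ->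
  differentiable g x /\ 'd g x = 'd f x :> (V -> W).
Proof.
move=> fg /diff_locallyP[dfc dfx].
have dgx : g \o shift x = cst (g x) + 'd f x +o_ 0 id.
  apply/eqaddoP => e e0.
  move/eqaddoP : dfx => /(_ e e0); apply: filter_app.
  have := fg; rewrite (near_shift 0) subr0; apply: filter_app.
  near=> h => /= fgh; rewrite !fctE /= -(nbhs_singleton fg).
  by rewrite -[h + x]/((shift x) h) fgh.
have dgf : 'd g x = 'd f x :> (V -> W) by exact: diff_unique.
split; last exact: dgf.
by apply/diff_locallyP; rewrite dgf; exact: (conj dfc dgx).
Unshelve. all: by end_near. Qed.

(** Openness turns equality on [A] into equality near each of its points, so the derivatives agree
    on [A] too and the induction goes through. This is what allows a derivative to be replaced by a
    formula valid on [A] only. *)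
Lemma Ck_on_eq V W k (A : set V) (f g : V -> W) : open A ->
  (forall x, A x -> f x = g x) -> Ck_on k A f -> Ck_on k A g.
Proof.
move=> oA; elim: k f g => [|k IH] f g fg.
  move=> cf x Ax; have := cf x Ax.
  rewrite /prop_for /continuous_at -fg//; apply: cvg_trans; apply: near_eq_cvg.
  by near do apply: fg; exact: open_nbhs_nbhs.
move=> [df Cf].
have nfg x : A x -> {near x, f =1 g}.
  by move=> Ax; near do apply: fg; exact: open_nbhs_nbhs.
split=> [x Ax|v]; first by case: (near_eq_diff (nfg x Ax) (df x Ax)).
apply: IH (Cf v) => x Ax; exact/near_eq_derive/nfg.
Unshelve. all: by end_near. Qed.

Lemma Ck_onW V W k (A : set V) (f : V -> W) : Ck_on k.+1 A f -> Ck_on k A f.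
Proof.
elim: k f => [|k IH] f [df Cf].
  by move=> x Ax; exact/differentiable_continuous/df.
by split=> // v; exact/IH/Cf.
Qed.

Lemma Ck_on_cst V W k (A : set V) (c : W) : Ck_on k A (cst c).
Proof.
elim: k c => [|k IH] c; first by move=> x _; exact: cst_continuous.
split=> [x _|v]; first exact: differentiable_cst.
by rewrite (_ : (fun x => _) = cst 0)//; apply/funext => x; rewrite derive_cst.
Qed.

Lemma Ck_onD V W k (A : set V) (f g : V -> W) : open A ->
  Ck_on k A f -> Ck_on k A g -> Ck_on k A (fun x => f x + g x).
Proof.
move=> oA; elim: k f g => [|k IH] f g.
  by move=> cf cg x Ax; apply: continuousD; [exact: cf|exact: cg].
move=> [df Cf] [dg Cg]; split=> [x Ax|v].
  by apply: differentiableD; [exact: df|exact: dg].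
apply: (Ck_on_eq oA _ (IH _ _ (Cf v) (Cg v))) => x Ax.
by rewrite -deriveD//; apply/diff_derivable; [exact: df|exact: dg].
Qed.

Lemma diff_linear_comp V W (W' : normedModType R) (L : W -> W') (f : V -> W) x :
  linear L -> continuous L -> differentiable f x ->
  differentiable (L \o f) x /\ 'd (L \o f) x = L \o 'd f x :> (V -> W').
Proof.
move=> linL cL df.
(* The bare function [L] is bundled into a linear map, to which the chain rule and the differential
   of linear maps apply. *)
pose M := GRing.isLinear.Build _ _ _ _ _ linL.
pose l : {linear W -> W'} := HB.pack L M.
have dl : differentiable l (f x) by exact: linear_differentiable.
split; first exact: (@differentiable_comp _ _ _ _ f l).
by rewrite (@diff_comp _ _ _ _ f l)// (@diff_lin _ _ _ l).
Qed.

Lemma derive_linear_comp V W (W' : normedModType R) (L : W -> W') (f : V -> W) x v :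
  linear L -> continuous L -> differentiable f x ->
  'D_v (L \o f) x = L ('D_v f x).
Proof.
move=> linL cL df; have [dL eL] := diff_linear_comp linL cL df.
by rewrite !deriveE// eL.
Qed.

Lemma Ck_on_linear_comp V W (W' : normedModType R) k (A : set V) (L : W -> W')
    (f : V -> W) : open A ->
  linear L -> continuous L -> Ck_on k A f -> Ck_on k A (L \o f).
Proof.
move=> oA linL cL; elim: k f => [|k IH] f.
  by move=> cf x Ax; apply: continuous_comp; [exact: cf|exact: cL].
move=> [df Cf]; split=> [x Ax|v].
  by have [] := diff_linear_comp linL cL (df x Ax).
apply: (Ck_on_eq oA _ (IH _ (Cf v))) => x Ax /=.
by rewrite derive_linear_comp//; exact: df.
Qed.

(** Leibniz: the derivative is a sum of products of C^k factors, the undifferentiated factor being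
    lowered from C^(k+1) to C^k. *)
Lemma Ck_onM V k (A : set V) (f g : V -> R^o) : open A ->
  Ck_on k A f -> Ck_on k A g -> Ck_on k A (fun x => f x * g x : R^o).
Proof.
move=> oA; elim: k f g => [|k IH] f g.
  by move=> cf cg x Ax; apply: (@continuousM R); [exact: cf|exact: cg].
move=> Cf' Cg'; have [df Cf] := Cf'; have [dg Cg] := Cg'; split=> [x Ax|v].
  by apply: differentiableM; [exact: df|exact: dg].
apply: (Ck_on_eq oA _ (Ck_onD oA
  (IH _ _ (Ck_onW Cf') (Cg v)) (IH _ _ (Ck_onW Cg') (Cf v)))).
by move=> x Ax; rewrite deriveM//; apply/diff_derivable; [exact: df|exact: dg].
Qed.

(** The derivative of [f^-1] is [-1 * (f^-1 * f^-1 * f')], whose factors are C^k by the induction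
    hypothesis for [f^-1]. *)
Lemma Ck_onV V k (A : set V) (f : V -> R^o) : open A ->
  (forall x, A x -> f x != 0) -> Ck_on k A f -> Ck_on k A (fun x => (f x)^-1 : R^o).
Proof.
move=> oA f0; elim: k f f0 => [|k IH] f f0.
  by move=> cf x Ax; apply: (@continuousV R); [exact: f0|exact: cf].
move=> Cf'; have [df Cf] := Cf'; split=> [x Ax|v].
  by apply: differentiableV; [exact: df|exact: f0].
have Cfi := IH _ f0 (Ck_onW Cf').
have C1 : Ck_on k A (cst (-1 : R^o) : V -> R^o) by exact: Ck_on_cst.
apply: (Ck_on_eq oA _ (Ck_onM oA C1 (Ck_onM oA (Ck_onM oA Cfi Cfi) (Cf v)))).
move=> x Ax; rewrite deriveV; [|exact: f0|exact/diff_derivable/df].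
by rewrite /cst mulN1r scaleNr -expr2 exprVn.
Qed.

End Ck.

(** * Continuous square roots, and symmetry of second derivatives *)

Section Schwarz.
Context {R : realType} {V : normedModType R}.

(** By continuity [g] keeps its sign near [x], hence equals [Num.sg (g x)] times the square root of
    [q] there, and [q x > 0]. *)
Lemma differentiable_sqr_root (g q : V -> R^o) (x : V) :
  {for x, continuous g} -> g x != 0 -> {near x, forall y, g y ^+ 2 = q y} ->
  differentiable q x -> differentiable g x.
Proof.
move=> cg g0 gq dq.
have q0 : 0 < q x by rewrite -(nbhs_singleton gq) exprn_even_gt0.
have dsqrt : differentiable (Num.sqrt : R^o -> R^o) (q x).
  by apply/derivable1_diffP; have [] := is_derive1_sqrt q0.
have dsq : differentiable (Num.sqrt \o q : V -> R^o) x.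
  exact: differentiable_comp.
have dsg : differentiable (Num.sg (g x) \*: (Num.sqrt \o q : V -> R^o)) x.
  exact: differentiableZ.
suff gsg : {near x, Num.sg (g x) \*: (Num.sqrt \o q : V -> R^o) =1 g}.
  by have [] := near_eq_diff gsg dsg.
have sgg : \forall y \near x, 0 < Num.sg (g x) * g y.
  have : Num.sg (g x) * g y @[y --> x] --> Num.sg (g x) * g x.
    by apply: cvgM; [exact: cvg_cst|exact: cg].
  by move=> /cvgr_gt; apply; rewrite -normrEsg normr_gt0.
near=> y.
have gy : 0 < Num.sg (g x) * g y by near: y.
rewrite /= -(near gq y)// sqrtr_sqr.
have sg1 : Num.sg (g x) ^+ 2 = 1 by rewrite sqr_sg g0.
have -> : `|g y| = Num.sg (g x) * g y.
  by rewrite -(gtr0_norm gy) normrM normr_sg g0 mul1r.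
by rewrite -[LHS]/(_ * (_ * _)) mulrA -expr2 sg1 mul1r.
Unshelve. all: by end_near. Qed.

(** Bootstrap: differentiating [g ^+ 2 = q] gives g' = q' / (2 g), so C^k regularity of [g] yields
    C^(k+1). The induction starts from the assumed continuity. *)
Lemma Ck_on_sqr_root k (A : set V) (g q : V -> R^o) : open A ->
  (forall x, A x -> {for x, continuous g}) -> (forall x, A x -> g x != 0) ->
  (forall x, A x -> g x ^+ 2 = q x) -> Ck_on k A q -> Ck_on k A g.
Proof.
move=> oA cg g0 gq; elim: k => [//|k IH] Cq'; have [dq Cq] := Cq'.
have ngq x : A x -> {near x, forall y, g y ^+ 2 = q y}.
  by move=> Ax; near do apply: gq; exact: open_nbhs_nbhs.
have dg x : A x -> differentiable g x.
  move=> Ax.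
  by apply: (differentiable_sqr_root (cg x Ax) (g0 x Ax) (ngq x Ax) (dq x Ax)).
split=> // v.
have Cg := IH (Ck_onW Cq').
have C2 : Ck_on k A (cst (2^-1 : R^o) : V -> R^o) by exact: Ck_on_cst.
apply: (Ck_on_eq oA _ (Ck_onM oA C2 (Ck_onM oA (Cq v) (Ck_onV oA g0 Cg)))).
move=> x Ax.
have dgx : derivable g x v by exact/diff_derivable/dg.
have -> : 'D_v q x = 'D_v (g * g) x.
  by apply: near_eq_derive; near=> y; rewrite -(near (ngq x Ax) y)// expr2.
rewrite deriveM// /cst -[g x *: _]/(_ * _).
by field; exact: g0.
Unshelve. all: by end_near. Qed.

(** Both difference quotients are the same function of [h]. The restriction to a line brings in the
    one-variable mean value theorem. *)
Lemma is_derive_line (W : normedModType R) (f : V -> W) (y v : V) (s : R) :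
  differentiable f (y + s *: v) ->
  is_derive s 1 (fun s : R => f (y + s *: v)) ('D_v f (y + s *: v)).
Proof.
move=> df.
have eqg : (fun h : R => h^-1 *: (((fun s => f (y + s *: v)) \o shift s) (h *: (1:R))
      - f (y + s *: v)))
   = (fun h : R => h^-1 *: ((f \o shift (y + s *: v)) (h *: v) - f (y + s *: v))).
  apply/funext => h /=; congr (_ *: (f _ - _)).
  by rewrite -[h *: 1]/(h * 1) mulr1 scalerDl addrCA.
split; first by rewrite /derivable eqg; exact/diff_derivable.
by rewrite /derive eqg.
Qed.

(** Continuity of (s, r) |-> x + s v + r w at the origin. *)
Lemma near_plane (P : set V) (x v w : V) : (\forall y \near x, P y) ->
  exists2 d : R, 0 < d & forall s r, `|s| < d -> `|r| < d -> P (x + s *: v + r *: w).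
Proof.
move=> Px.
have c : (x + z.1 *: v + z.2 *: w) @[z --> ((0, 0) : R * R)] --> x.
  rewrite -[X in _ --> X]addr0 -(scale0r w) -[X in _ --> X + _]addr0 -(scale0r v).
  apply: cvgD; first apply: cvgD; first exact: cvg_cst.
    by apply: cvgZr_tmp; exact: cvg_fst.
  by apply: cvgZr_tmp; exact: cvg_snd.
have /nbhs_ballP[d d0 dP] := c _ Px.
exists d => // s r sd rd.
by apply: (dP (s, r)); split; rewrite /ball /= sub0r normrN.
Qed.

(** Two uses of the mean value theorem: first in the direction [v], for the increment of [f] along
    [t *: w], then in the direction [w], for ['D_v f]. *)
Lemma second_difference (A : set V) (f : V -> R^o) (x v w : V) (t : R) :
  Ck_on 2 A f -> 0 < t ->
  (forall s r, s \in `[0, t] -> r \in `[0, t] -> A (x + s *: v + r *: w)) ->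
  exists s r, [/\ s \in `]0, t[, r \in `]0, t[ &
    f (x + t *: v + t *: w) - f (x + t *: v) - (f (x + t *: w) - f x) =
    'D_w (fun y => 'D_v f y) (x + s *: v + r *: w) * t * t].
Proof.
move=> [df Cf] t0 At.
have t00 : 0 \in `[0, t] by rewrite in_itv /= lexx ltW.
have tt : t \in `[0, t] by rewrite in_itv /= lexx ltW.
have oc (s : R) : s \in `]0, t[ -> s \in `[0, t] by exact: subset_itv_oo_cc.
pose g (s : R) : R := f (x + t *: w + s *: v) - f (x + s *: v).
pose dg (s : R) : R := 'D_v f (x + t *: w + s *: v) - 'D_v f (x + s *: v).
have gd s : s \in `[0, t] -> is_derive s (1:R) g (dg s).
  move=> st; apply: is_deriveB; apply: is_derive_line.
    by rewrite addrAC; apply/df/At.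
  by have := At _ _ st t00; rewrite scale0r addr0; exact: df.
have [|s st gst] := @MVT R g dg 0 t t0 (fun s st => gd s (oc _ st)).
  by apply: derivable_within_continuous => s st; have [] := gd s st.
pose k (r : R) : R := 'D_v f (x + s *: v + r *: w).
pose dk (r : R) : R := 'D_w (fun y => 'D_v f y) (x + s *: v + r *: w).
have kd r : r \in `[0, t] -> is_derive r (1:R) k (dk r).
  move=> rt; apply: is_derive_line.
  by have [dDf _] := Cf v; apply/dDf/At => //; exact: oc.
have [|r rt krt] := @MVT R k dk 0 t t0 (fun r rt => kd r (oc _ rt)).
  by apply: derivable_within_continuous => r rt; have [] := kd r rt.
exists s, r; split=> //.
move: gst krt; rewrite /g /dg /k !subr0 !scale0r !addr0 => gst krt.
by rewrite -krt [x + s *: v + _]addrAC -gst [x + t *: w + _]addrAC.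
Qed.

(* Both iterated second derivatives are approximated arbitrarily well by the
   same second difference quotient, by [second_difference] in either order. *)
Lemma derive_comm (A : set V) (f : V -> R^o) (x v w : V) :
  open A -> Ck_on 2 A f -> A x ->
  'D_v (fun y => 'D_w f y) x = 'D_w (fun y => 'D_v f y) x.
Proof.
move=> oA C2 Ax; have [_ C1] := C2.
have cvw a b : {for x, continuous (fun y => 'D_a (fun z => 'D_b f z) y)}.
  by have [_ /(_ a)] := C1 b; exact.
apply/eqP; rewrite -subr_eq0 -normr_le0; apply/ler_addgt0Pr => e e0; rewrite add0r.
have nA : \forall y \near x, A y by exact: open_nbhs_nbhs.
have e2 : 0 < e / 2 by rewrite divr_gt0.
have /cvgrPdist_lt/(_ _ e2) n1 := cvw v w.
have /cvgrPdist_lt/(_ _ e2) n2 := cvw w v.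
have [d1 d10 P1] := near_plane v w (filterI nA (filterI n1 n2)).
have [d2 d20 P2] := near_plane w v (filterI nA (filterI n1 n2)).
(* Halving makes [t] strictly smaller than both radii, so the closed square of side [t] lies in both
   good neighbourhoods. *)
pose t := Num.min d1 d2 / 2.
have t0 : 0 < t by rewrite divr_gt0// lt_min d10.
have td : t < Num.min d1 d2 by rewrite ltr_pdivrMr// ltr_pMr ?ltr1n// lt_min d10.
have [td1 td2] : t < d1 /\ t < d2 by move: td; rewrite lt_min => /andP.
have it (d s : R) : t < d -> s \in `[0, t] -> `|s| < d.
  by move=> ltd; rewrite in_itv /= => /andP[s0 st]; rewrite ger0_norm// (le_lt_trans st).
have oc (s : R) : s \in `]0, t[ -> s \in `[0, t] by exact: subset_itv_oo_cc.
have [s [r [st rt E1]]] := @second_difference A f x v w t C2 t0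
  (fun s r st rt => (P1 s r (it _ _ td1 st) (it _ _ td1 rt)).1).
have [s' [r' [st' rt' E2]]] := @second_difference A f x w v t C2 t0
  (fun s r st rt => (P2 s r (it _ _ td2 st) (it _ _ td2 rt)).1).
have [_ [_ B1]] := P1 s r (it _ _ td1 (oc _ st)) (it _ _ td1 (oc _ rt)).
have [_ [B2 _]] := P2 s' r' (it _ _ td2 (oc _ st')) (it _ _ td2 (oc _ rt')).
(* The second difference is symmetric in [v] and [w], so its two expressions agree once [t * t] is
   cancelled. *)
have E : 'D_w (fun y => 'D_v f y) (x + s *: v + r *: w) =
    'D_v (fun y => 'D_w f y) (x + s' *: w + r' *: v).
  have mulI2 (a b : R) : a * t * t = b * t * t -> a = b.
    by move=> /(mulIf (lt0r_neq0 t0)) /(mulIf (lt0r_neq0 t0)).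
  have subACA (a b c d : R) : a - b - (c - d) = a - c - (b - d) by ring.
  apply: mulI2; apply: etrans (esym E1) _; apply: etrans _ E2.
  rewrite (addrAC x (t *: w)); exact: subACA.
(* Triangle inequality through the common intermediate value, each half costing [e / 2]. *)
move: B1 B2; rewrite E => B1 B2.
rewrite (splitr e); apply: ltW; rewrite distrC in B1.
by apply: le_lt_trans (ltrD B2 B1); exact: ler_distD.
Qed.

End Schwarz.

(** * Dot and cross products in three dimensions *)

Section Row3.
Context {R : realType}.
Implicit Types x y a b n : 'rV[R]_3.

Lemma dotE x y : dot x y = x 0 0 * y 0 0 + x 0 1 * y 0 1 + x 0 2%:R * y 0 2%:R.
Proof.
rewrite /dot !big_ord_recl big_ord0 addr0 addrA.
have -> : lift ord0 ord0 = 1 :> 'I_3 by exact: val_inj.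
by have -> : lift ord0 (lift ord0 ord0) = 2%:R :> 'I_3 by exact: val_inj.
Qed.

Lemma dotC x y : dot x y = dot y x.
Proof. by rewrite !dotE; ring. Qed.

Lemma dotDl x y n : dot (x + y) n = dot x n + dot y n.
Proof. by rewrite !dotE !mxE; ring. Qed.

Lemma dotBl x y n : dot (x - y) n = dot x n - dot y n.
Proof. by rewrite !dotE !mxE; ring. Qed.

Lemma dotZl r x n : dot (r *: x) n = r * dot x n.
Proof. by rewrite !dotE !mxE; ring. Qed.

Lemma dotDr n x y : dot n (x + y) = dot n x + dot n y.
Proof. by rewrite !(dotC n) dotDl. Qed.

Lemma dotBr n x y : dot n (x - y) = dot n x - dot n y.
Proof. by rewrite !(dotC n) dotBl. Qed.

Lemma dotZr r n x : dot n (r *: x) = r * dot n x.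
Proof. by rewrite !(dotC n) dotZl. Qed.

Lemma dot_eq0 x : (dot x x == 0) = (x == 0).
Proof.
rewrite /dot psumr_eq0; last by move=> i _; rewrite -expr2 sqr_ge0.
apply/allP/eqP => [x0|-> i _]; last by rewrite mxE mul0r eqxx.
apply/rowP => i; have := x0 i (mem_index_enum i).
by rewrite mulf_eq0 orbb mxE => /eqP.
Qed.

Lemma enorm_eq1 x : enorm x = 1 <-> dot x x = 1.
Proof.
have xx0 : 0 <= dot x x by apply: sumr_ge0 => i _; rewrite -expr2 sqr_ge0.
rewrite /enorm; split=> [E|->]; last by rewrite sqrtr1.
by rewrite -[LHS]sqr_sqrtr// E expr1n.
Qed.

(** Indices in ['I_3] add modulo 3, so a single cyclic formula covers the three components. *)
Definition cross a b : 'rV[R]_3 := \row_(i < 3)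
  (a 0 (i + 1) * b 0 (i + 2%:R) - a 0 (i + 2%:R) * b 0 (i + 1)).

Lemma crossE a b : [/\ cross a b 0 0 = a 0 1 * b 0 2%:R - a 0 2%:R * b 0 1,
  cross a b 0 1 = a 0 2%:R * b 0 0 - a 0 0 * b 0 2%:R &
  cross a b 0 2%:R = a 0 0 * b 0 1 - a 0 1 * b 0 0].
Proof.
have e12 : 1 + 2%:R = 0 :> 'I_3 by exact: val_inj.
have e22 : 2%:R + 2%:R = 1 :> 'I_3 by exact: val_inj.
by split; rewrite mxE ?add0r ?e12 ?e22 ?(addrC 2%:R 1) ?e12 -?[1 + 1]/(2%:R).
Qed.

Lemma row3P x y : x 0 0 = y 0 0 -> x 0 1 = y 0 1 -> x 0 2%:R = y 0 2%:R -> x = y.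
Proof.
move=> e0 e1 e2; apply/rowP => -[[|[|[|//]]] i3].
- by rewrite (_ : Ordinal i3 = 0); last exact: val_inj.
- by rewrite (_ : Ordinal i3 = 1); last exact: val_inj.
- by rewrite (_ : Ordinal i3 = 2%:R); last exact: val_inj.
Qed.

(** The vector triple product formula, a polynomial identity in the coordinates. *)
Lemma cross_cross a b n :
  cross (cross a b) n = dot a n *: b - dot b n *: a.
Proof.
have [c0 c1 c2] := crossE a b; have [d0 d1 d2] := crossE (cross a b) n.
by apply: row3P; rewrite (d0, d1, d2) !(c0, c1, c2) !mxE !dotE; ring.
Qed.

(** The triple product formula with third vector [a]. *)
Lemma cross_eq0 a b : cross a b = 0 -> dot a a *: b = dot a b *: a.
Proof.
move=> ab0; apply/subr0_eq; rewrite (dotC a b) -cross_cross ab0.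
by apply/rowP => i; rewrite !mxE !mul0r subrr.
Qed.

(** By the triple product formula [cross (cross a b) n] vanishes, so [cross_eq0] applies to
    [cross a b] and [n]. *)
Lemma normal_cross a b n : dot a n = 0 -> dot b n = 0 ->
  dot (cross a b) (cross a b) *: n = dot (cross a b) n *: cross a b.
Proof.
by move=> an bn; apply: cross_eq0; rewrite cross_cross an bn !scale0r subrr.
Qed.

End Row3.

(** * Differential calculus of pairs, row vectors and products *)

Section VectorCalculus.
Context {R : realType} {V : normedModType R}.

(** The pair is the sum of [inl \o f] and [inr \o g], two compositions with continuous linear
    injections. *)
Lemma Ck_on_pair (W W' : normedModType R) k (A : set V) (f : V -> W) (g : V -> W') :
  open A -> Ck_on k A f -> Ck_on k A g -> Ck_on k A (fun x => (f x, g x)).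
Proof.
move=> oA Cf Cg.
pose inl (y : W) : W * W' := (y, 0).
pose inr (y : W') : W * W' := (0, y).
have linl : linear inl by move=> r x y; congr pair; rewrite /= scaler0 addr0.
have linr : linear inr by move=> r x y; congr pair; rewrite /= scaler0 addr0.
have cinl : continuous inl.
  by move=> y; apply: cvg_pair; [exact: cvg_id|exact: cvg_cst].
have cinr : continuous inr.
  by move=> y; apply: cvg_pair; [exact: cvg_cst|exact: cvg_id].
apply: (Ck_on_eq oA _ (Ck_onD oA (Ck_on_linear_comp oA linl cinl Cf)
  (Ck_on_linear_comp oA linr cinr Cg))) => x _.
by congr pair; rewrite ?addr0 ?add0r.
Qed.

Lemma Ck_on_sum (W : normedModType R) k (A : set V) n (f : 'I_n -> V -> W) :
  open A -> (forall i, Ck_on k A (f i)) -> Ck_on k A (fun x => \sum_i f i x).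
Proof.
move=> oA Cf; elim: n f Cf => [|n IH] f Cf.
  by apply: (Ck_on_eq oA _ (Ck_on_cst k A 0)) => x _; rewrite big_ord0.
apply: (Ck_on_eq oA _ (Ck_onD oA (Cf ord0) (IH _ (fun i => Cf (lift ord0 i))))).
by move=> x _; rewrite big_ord_recl.
Qed.

Lemma coord_linear n (i : 'I_n) : linear (fun y : 'rV[R]_n => y 0 i : R^o).
Proof. by move=> r x y; rewrite !mxE. Qed.

Lemma Ck_on_coord n k (A : set V) (f : V -> 'rV[R]_n) (i : 'I_n) : open A ->
  Ck_on k A f -> Ck_on k A (fun x => f x 0 i : R^o).
Proof.
move=> oA Cf.
exact: (Ck_on_linear_comp oA (coord_linear i) (@coord_continuous _ _ _ 0 i) Cf).
Qed.

Lemma Ck_on_row n k (A : set V) (f : V -> 'rV[R]_n) : open A ->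
  (forall i, Ck_on k A (fun x => f x 0 i : R^o)) -> Ck_on k A f.
Proof.
move=> oA Cf.
have Ci i : Ck_on k A (fun x => f x 0 i *: delta_mx 0 i : 'rV[R]_n).
  pose L (r : R^o) : 'rV[R]_n := r *: delta_mx 0 i.
  have linL : linear L by move=> r x y; rewrite /L scalerDl scalerA.
  have cL : continuous L by move=> r; apply: cvgZr_tmp; exact: cvg_id.
  exact: (Ck_on_linear_comp oA linL cL (Cf i)).
by apply: (Ck_on_eq oA _ (Ck_on_sum oA Ci)) => x _; rewrite -row_sum_delta.
Qed.

Lemma Ck_onZ n k (A : set V) (f : V -> R^o) (g : V -> 'rV[R]_n) : open A ->
  Ck_on k A f -> Ck_on k A g -> Ck_on k A (fun x => f x *: g x).
Proof.
move=> oA Cf Cg; apply: Ck_on_row => // i.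
apply: (Ck_on_eq oA _ (Ck_onM oA Cf (Ck_on_coord i oA Cg))) => x _.
by rewrite mxE.
Qed.

Lemma Ck_onB (W : normedModType R) k (A : set V) (f g : V -> W) : open A ->
  Ck_on k A f -> Ck_on k A g -> Ck_on k A (fun x => f x - g x).
Proof.
move=> oA Cf Cg.
have linN : linear (-%R : W -> W) by move=> r x y; rewrite scalerN opprD.
have CN := Ck_on_linear_comp oA linN (@opp_continuous W) Cg.
by apply: (Ck_on_eq oA _ (Ck_onD oA Cf CN)).
Qed.

Lemma Ck_on_dot k (A : set V) (f g : V -> 'rV[R]_3) : open A ->
  Ck_on k A f -> Ck_on k A g -> Ck_on k A (fun x => dot (f x) (g x) : R^o).
Proof.
move=> oA Cf Cg; apply: (@Ck_on_sum R^o _ _ _ (fun i x => f x 0 i * g x 0 i)) => // i.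
exact: (Ck_onM oA (Ck_on_coord i oA Cf) (Ck_on_coord i oA Cg)).
Qed.

Lemma Ck_on_cross k (A : set V) (f g : V -> 'rV[R]_3) : open A ->
  Ck_on k A f -> Ck_on k A g -> Ck_on k A (fun x => cross (f x) (g x)).
Proof.
move=> oA Cf Cg; apply: Ck_on_row => // i.
have C j := Ck_on_coord j oA Cf; have D j := Ck_on_coord j oA Cg.
apply: (Ck_on_eq oA _ (Ck_onB oA (Ck_onM oA (C (i + 1)) (D (i + 2%:R)))
   (Ck_onM oA (C (i + 2%:R)) (D (i + 1))))) => x _.
by rewrite mxE.
Qed.

Lemma derive_coord n (f : V -> 'rV[R]_n) (i : 'I_n) (x v : V) :
  differentiable f x -> 'D_v (fun y => f y 0 i : R^o) x = ('D_v f x) 0 i.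
Proof.
exact: (derive_linear_comp v (coord_linear i) (@coord_continuous _ _ _ 0 i)).
Qed.

Lemma differentiable_row_coord n (f : V -> 'rV[R]_n) (i : 'I_n) (x : V) :
  differentiable f x -> differentiable (fun y => f y 0 i : R^o) x.
Proof.
by move/(diff_linear_comp (coord_linear i) (@coord_continuous _ _ _ 0 i)) => [].
Qed.

Lemma derive_scale n (f : V -> R^o) (g : V -> 'rV[R]_n) (x v : V) :
  differentiable f x -> differentiable g x ->
  differentiable (fun y => f y *: g y) x ->
  'D_v (fun y => f y *: g y) x = 'D_v f x *: g x + f x *: 'D_v g x.
Proof.
move=> df dg dfg; apply/rowP => i.
rewrite -derive_coord// (_ : (fun y => _) = f * (fun y => g y 0 i : R^o)); last first.
  by apply/funext => y; rewrite mxE.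
have dgi := differentiable_row_coord i dg.
rewrite deriveM; [|exact: diff_derivable..].
by rewrite derive_coord// !mxE addrC; congr (_ + _); rewrite mulrC.
Qed.

Lemma derive_dot (f g : V -> 'rV[R]_3) (x v : V) :
  differentiable f x -> differentiable g x ->
  'D_v (fun y => dot (f y) (g y) : R^o) x = dot ('D_v f x) (g x) + dot (f x) ('D_v g x).
Proof.
move=> df dg.
pose fi i : V -> R^o := fun y => f y 0 i.
pose gi i : V -> R^o := fun y => g y 0 i.
have D i : is_derive x v (fi i * gi i)
    (('D_v f x) 0 i * g x 0 i + f x 0 i * ('D_v g x) 0 i).
  have dfi : derivable (fi i) x v by exact/diff_derivable/differentiable_row_coord.
  have dgi : derivable (gi i) x v by exact/diff_derivable/differentiable_row_coord.
  split; first exact: (@derivableM _ _ (fi i) (gi i)).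
  rewrite (@deriveM _ _ (fi i) (gi i) x v dfi dgi).
  rewrite (derive_coord i v df) (derive_coord i v dg).
  by rewrite -![_ *: _]/(_ * _) addrC [gi i x * _]mulrC.
have [_] := is_derive_sum D; rewrite big_split /= => <-.
by congr ('D_v _ x); apply/funext => y; rewrite /dot fct_sumE.
Qed.

End VectorCalculus.

(** * Restriction of a family to fixed parameter or fixed point *)

Section Slices.
Context {R : realType} {V W : normedModType R}.
Implicit Type f : R^o * V -> W.

Lemma diff_slice f (e : R^o) (u : V) : differentiable f (e, u) ->
  differentiable (fun v => f (e, v)) u /\
  forall v, 'd (fun v => f (e, v)) u v = 'D_((0, v) : R^o * V) f (e, u).
Proof.
move=> df; pose iota (v : V) : R^o * V := (e, v).
have diota : differentiable iota u by apply: differentiable_pair.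
split; first exact: (@differentiable_comp _ _ _ _ iota f).
move=> v; rewrite (@diff_comp _ _ _ _ iota f)//= (@diff_pair _ _ _ _ (cst e) id)//.
by rewrite diff_cst diff_val -deriveE.
Qed.

(** The derivative of a slice along [v] is the slice of the derivative along [(0, v)], which feeds
    the induction. *)
Lemma Ck_on_slice k (I : set R^o) (U : set V) f (e : R^o) : open U -> I e ->
  Ck_on k (I `*` U) f -> Ck_on k U (fun v => f (e, v)).
Proof.
move=> oU Ie; elim: k f => [|k IH] f.
  move=> cf u Uu; apply: (@continuous_comp _ _ _ (fun v : V => (e, v) : R^o * V) f).
    by apply: (@cvg_pair _ _ _ _ (nbhs e) (nbhs u)); [exact: cvg_cst|exact: cvg_id].
  exact: (cf (e, u) (conj Ie Uu)).
move=> [df Cf].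
have ds u : U u -> _ := fun Uu => diff_slice (df (e, u) (conj Ie Uu)).
split=> [u Uu|v]; first by have [] := ds u Uu.
apply: (Ck_on_eq oU _ (IH _ (Cf ((0, v) : R^o * V)))) => u Uu.
by have [d1 d2] := ds u Uu; rewrite -d2 deriveE.
Qed.

Lemma derive1_slice f (e : R^o) (u : V) :
  (fun t : R => f (t, u))^`()%classic e = 'D_((1, 0) : R^o * V) f (e, u).
Proof.
rewrite derive1E.
have eqg : (fun h : R => h^-1 *: (((fun t : R => f (t, u)) \o shift e) (h *: (1 : R))
      - f (e, u))) = (fun h : R => h^-1 *: ((f \o shift ((e, u) : R^o * V))
      (h *: ((1, 0) : R^o * V)) - f (e, u))).
  apply/funext => h /=; congr (_ *: (f (_, _) - _)).
  by rewrite /= scaler0 add0r.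
by rewrite /derive eqg.
Qed.

End Slices.

Lemma derive_comm_row (R : realType) (V : normedModType R) n (A : set V)
    (f : V -> 'rV[R]_n) (x v w : V) : open A -> Ck_on 2 A f -> A x ->
  'D_v (fun y => 'D_w f y) x = 'D_w (fun y => 'D_v f y) x.
Proof.
move=> oA C2 Ax; have [df Df] := C2.
have dDf u : differentiable (fun y => 'D_u f y) x := (Df u).1 x Ax.
apply/rowP => i.
(* Equality is needed on a neighbourhood, not just at [x], because both sides are differentiated
   once more. *)
have E u : \forall y \near x, 'D_u f y 0 i = 'D_u (fun z => f z 0 i : R^o) y.
  near=> y; apply/esym/derive_coord/df; near: y; exact: open_nbhs_nbhs.
have D u t : 'D_u (fun z => 'D_t (fun z => f z 0 i : R^o) z) x =
    ('D_u (fun y => 'D_t f y) x) 0 i.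
  by apply: etrans (derive_coord i u (dDf t)); exact/esym/near_eq_derive/E.
apply: etrans (esym (D v w)) _; apply: etrans _ (D w v).
exact: (derive_comm v w oA (Ck_on_coord i oA C2) Ax).
Unshelve. all: by end_near. Qed.

(** The local [foot xa na] is the derivative of X - <X, N> N when X and N have derivatives [xa] and
    [na]. Multiples of [n] are orthogonal to [nv] and [nw], and the two terms in
    [dot x n * dot nv nw] cancel. *)
Lemma Omega_foot (R : realType) (n x y nv nw xv xw : 'rV[R]_3) :
  dot n n = 1 -> dot n nv = 0 -> dot n nw = 0 ->
  let foot xa na := xa - ((dot xa n + dot x na) *: n + dot x n *: na) in
  Omega (n, y) (nv, foot xv nv) (nw, foot xw nw) = dot xv nw - dot xw nv.
Proof.
move=> n1 nv0 nw0; rewrite /Omega /K_TS2 /P_TS2 /=.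
have nv0' : dot nv n = 0 by rewrite dotC.
rewrite !(dotBl, dotBr).
rewrite !(dotDl, dotDr) !(dotZl, dotZr) n1 nw0 nv0'.
by rewrite (dotC nv nw) (dotC nv xw); ring.
Qed.

(** For tangential [xv] and [xw], the correction subtracted from them depends only on the derivative
    of the normal, so it is the same on both sides. *)
Lemma foot_inj (R : realType) (n x nv nw xv xw : 'rV[R]_3) :
  dot xv n = 0 -> dot xw n = 0 -> nv = nw ->
  let foot xa na := xa - ((dot xa n + dot x na) *: n + dot x n *: na) in
  foot xv nv = foot xw nw -> xv = xw.
Proof. by move=> /= -> -> -> /addIr. Qed.

(** * The normal congruence over an arbitrary parameter space *)

Section CongruenceDef.
Context {R : realType} {V : normedModType R}.
Variables (X N : V -> 'rV[R]_3).

(* The point nearest to the origin of the line through [X x] directed by [N x]. *)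
Definition foot x := X x - dot (X x) (N x) *: N x.

(* [normal_congruence] over an arbitrary parameter space, so that the deformation
   parameter can be one of the coordinates. *)
Definition congruence x := (N x, foot x).

End CongruenceDef.

Section Congruence.
Context {R : realType} {V : normedModType R}.
Variables (A : set V) (X N : V -> 'rV[R]_3).
Hypotheses (oA : open A) (sX : smooth_on A X) (sN : smooth_on A N).
Hypothesis NN : forall x, A x -> dot (N x) (N x) = 1.

Let dX x : A x -> differentiable X x := (sX 1).1 x.
Let dN x : A x -> differentiable N x := (sN 1).1 x.

Lemma smooth_congruence : smooth_on A (congruence X N).
Proof.
move=> k; apply: Ck_on_pair => //; apply: (Ck_onB oA (sX k)).
exact: (Ck_onZ oA (Ck_on_dot oA (sX k) (sN k)) (sN k)).
Qed.

Lemma congruence_TS2 x : A x -> TS2 (congruence X N x).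
Proof.
move=> Ax; split=> /=; first exact/enorm_eq1/NN.
by rewrite /foot dotBr dotZr NN// mulr1 (dotC (N x)) subrr.
Qed.

Lemma derive_near_cst (f : V -> R^o) c x v : A x -> (forall y, A y -> f y = c) ->
  'D_v f x = 0.
Proof.
move=> Ax fc; rewrite (@near_eq_derive _ _ _ f (cst c)) ?derive_cst//.
by near do apply: fc; exact: open_nbhs_nbhs.
Unshelve. all: by end_near. Qed.

(** Differentiating <N, N> = 1 gives twice this product. *)
Lemma derive_unit x v : A x -> dot (N x) ('D_v N x) = 0.
Proof.
move=> Ax; have := derive_near_cst v Ax NN.
rewrite derive_dot; [|exact: dN..].
rewrite (dotC ('D_v N x)) -mulr2n => /eqP; rewrite mulrn_eq0 => /eqP.
exact.
Qed.

Let dY x : A x -> differentiable (foot X N) x.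
Proof.
move=> Ax; have [dXN _] := smooth_congruence 1.
have [d _] := diff_linear_comp (L := snd) (f := fun x => (congruence X N x))
  ltac:(by []) ltac:(move=> z; exact: cvg_snd) (dXN x Ax).
exact: d.
Qed.

Lemma derive_foot x v : A x -> 'D_v (foot X N) x = 'D_v X x -
  ((dot ('D_v X x) (N x) + dot (X x) ('D_v N x)) *: N x + dot (X x) (N x) *: 'D_v N x).
Proof.
move=> Ax.
have dXN : differentiable (fun y => dot (X y) (N y) : R^o) x.
  exact: (Ck_on_dot (k := 1) oA (sX 1) (sN 1)).1.
have dXNN : differentiable (fun y => dot (X y) (N y) *: N y) x.
  exact: (Ck_onZ (k := 1) oA (Ck_on_dot oA (sX 1) (sN 1)) (sN 1)).1.
rewrite deriveB; [|exact/diff_derivable/dX|exact/diff_derivable].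
rewrite derive_scale//; [|exact: dN].
by rewrite derive_dot; [|exact: dX|exact: dN].
Qed.

Lemma derive_congruence x v : A x ->
  'D_v (congruence X N) x = ('D_v N x, 'D_v (foot X N) x).
Proof.
move=> Ax; rewrite deriveE; last exact: (smooth_congruence 1).1.
rewrite diff_pair; [|exact: dN|exact: dY].
by rewrite (deriveE v (dN Ax)) (deriveE v (dY Ax)).
Qed.

(** Reduces the injectivity of the differential of the congruence, along tangential directions, to
    that of the surface. *)
Lemma derive_congruence_inj x v w : A x ->
  dot ('D_v X x) (N x) = 0 -> dot ('D_w X x) (N x) = 0 ->
  'D_v (congruence X N) x = 'D_w (congruence X N) x -> 'D_v X x = 'D_w X x.
Proof.
move=> Ax XvN XwN Evw.
have [Nvw Yvw] : ('D_v N x, 'D_v (foot X N) x) = ('D_w N x, 'D_w (foot X N) x) :=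
  etrans (esym (derive_congruence v Ax)) (etrans Evw (derive_congruence w Ax)).
apply: (foot_inj XvN XwN Nvw).
exact: etrans (esym (derive_foot v Ax)) (etrans Yvw (derive_foot w Ax)).
Qed.

(** The two tangency equations are the derivatives of <N, N> = 1 and <N, Y> = 0 along the
    congruence. *)
Lemma congruence_tangent x v : A x ->
  tangent_TS2 (congruence X N x) ('D_v (congruence X N) x).
Proof.
move=> Ax; rewrite derive_congruence//; split=> /=; first exact: derive_unit.
rewrite -derive_dot; [|exact: dN|exact: dY].
by apply: derive_near_cst v Ax _ => y Ay; have [_ NY] := congruence_TS2 Ay; exact: NY.
Qed.

Lemma Omega_congruence x v w : A x ->
  Omega (congruence X N x) ('D_v (congruence X N) x) ('D_w (congruence X N) x) =
  dot ('D_v X x) ('D_w N x) - dot ('D_w X x) ('D_v N x).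
Proof.
move=> Ax; rewrite !derive_congruence// !derive_foot//.
by apply: Omega_foot; [exact: NN|exact: derive_unit..].
Qed.

Lemma Omega_congruence_exact x v w : A x ->
  (forall y, A y -> dot ('D_w X y) (N y) = 0) ->
  Omega (congruence X N x) ('D_v (congruence X N) x) ('D_w (congruence X N) x) =
  'D_w (fun y => dot ('D_v X y) (N y) : R^o) x.
Proof.
move=> Ax XwN; apply: etrans (Omega_congruence v w Ax) _.
have dDX u : differentiable (fun y => 'D_u X y) x := ((sX 2).2 u).1 x Ax.
apply: etrans _ (esym (derive_dot w (dDX v) (dN Ax))).
have subr_eqDl (a b c : R) : a + b = 0 -> c - b = a + c.
  by move=> /eqP; rewrite addr_eq0 => /eqP ->; rewrite addrC.
(* What remains is <D_w D_v X, N> + <D_w X, D_v N> = 0; after exchanging the derivatives, the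
   left-hand side is D_v <D_w X, N>. *)
apply: subr_eqDl; rewrite -(derive_comm_row v w oA (sX 2) Ax).
exact: etrans (esym (derive_dot v (dDX w) (dN Ax))) (derive_near_cst v Ax XwN).
Qed.

End Congruence.

(** * Smoothness of the unit normal *)

Lemma open_setX (T T' : topologicalType) (A : set T) (B : set T') :
  open A -> open B -> open (A `*` B).
Proof.
rewrite !openE => oA oB [x y] [/= /oA nA /oB nB].
by exists (A, B).
Qed.

(* With c := a x b, N = (<c, N> / <c, c>) c and <c, N>^2 = <c, c>, so that N is
   smooth as soon as it is continuous. *)
Lemma smooth_normal (R : realType) (V : normedModType R) (A : set V)
    (a b N : V -> 'rV[R]_3) : open A -> smooth_on A a -> smooth_on A b ->
  (forall x, A x -> {for x, continuous N}) ->
  (forall x, A x -> [/\ dot (N x) (N x) = 1, dot (a x) (N x) = 0,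
     dot (b x) (N x) = 0 & cross (a x) (b x) != 0]) ->
  smooth_on A N.
Proof.
move=> oA sa sb cN H.
pose c x := cross (a x) (b x).
pose q x : R^o := dot (c x) (c x).
pose g x : R^o := dot (c x) (N x).
have sc : smooth_on A c by move=> k; exact: Ck_on_cross.
have sq : smooth_on A q by move=> k; exact: Ck_on_dot.
have cNE x : A x -> q x *: N x = g x *: c x.
  by move=> /H[_ aN bN _]; exact: normal_cross.
have q0 x : A x -> q x != 0 by move=> /H[_ _ _ c0]; rewrite /q dot_eq0.
(* Pair the identity [q x *: N x = g x *: c x] with the unit vector [N x]. *)
have gq x : A x -> g x ^+ 2 = q x.
  move=> Ax; have [N1 _ _ _] := H x Ax.
  have := congr1 (fun y => dot y (N x)) (cNE x Ax).
  by rewrite !dotZl N1 mulr1 expr2 => ->.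
have g0 x : A x -> g x != 0 by move=> Ax; have := q0 x Ax; rewrite -gq// expf_eq0.
have cg x : A x -> {for x, continuous g}.
  exact: (Ck_on_dot (k := 0) oA (sc 0%N) cN).
have sg : smooth_on A g by move=> k; exact: (Ck_on_sqr_root oA cg g0 gq).
move=> k; apply: (Ck_on_eq oA _ (Ck_onZ oA (Ck_onM oA (Ck_onV oA q0 (sq k)) (sg k))
  (sc k))) => x Ax.
by rewrite -scalerA -cNE// scalerA mulVf ?q0// scale1r.
Qed.

(** If the product vanished, [cross_eq0] and injectivity would give <a, a> e_1 = <a, b> e_0 for the
    basis vectors; hence <a, a> = 0, so a = L e_0 = 0, contradicting injectivity. *)
Lemma cross_immersion (R : realType) (L : {linear 'rV[R]_2 -> 'rV[R]_3}) :
  injective L -> cross (L (delta_mx 0 0)) (L (delta_mx 0 1)) != 0.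
Proof.
move=> injL; apply/eqP => /cross_eq0; set a := L _; set b := L _ => /eqP.
rewrite -!linearZ => /eqP /injL /rowP /(_ 1); rewrite !mxE /= mulr1 mulr0 => /eqP.
rewrite dot_eq0 /a -(linear0 L) => /eqP /injL /rowP /(_ 0) /eqP.
by rewrite !mxE /= oner_eq0.
Qed.

(** * Verification of the Hamiltonian condition on each slice *)

Theorem lemma4p1 (R : realType) (I : set R) (U : set 'rV[R]_2)
    (X N : R -> 'rV[R]_2 -> 'rV[R]_3)
    (openI : open I) (intervalI : is_interval I) (openU : open U)
    (XN : oriented_surface_family I U X N) :
  hamiltonian_deformation I U (fun e => normal_congruence (X e) (N e)).
Proof.
have [sX cN immX nN] := XN.
pose E : normedModType R := (R^o * 'rV[R]_2)%type.
pose A : set E := I `*` U.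
have oA : open A by exact: open_setX.
pose Xf (z : E) := X z.1 z.2; pose Nf (z : E) := N z.1 z.2.
(* Directions tangent to the slices of constant deformation parameter. *)
pose d (v : 'rV[R]_2) : E := (0, v).
have sXf : smooth_on A Xf := sX.
have dXf z v : A z -> 'd (X z.1) (z.2) v = 'D_(d v) Xf z.
  case: z => e u Az /=.
  by have [_ <-] := diff_slice ((sXf 1).1 (e, u) Az).
have NN z : A z -> dot (Nf z) (Nf z) = 1.
  by case: z => e u [Ie Uu]; apply/enorm_eq1; have [] := nN e Ie u Uu.
have XvN v z : A z -> dot ('D_(d v) Xf z) (Nf z) = 0.
  move=> Az; rewrite -dXf//; case: z Az => e u [Ie Uu].
  by have [_] := nN e Ie u Uu; exact.
have sDX v : smooth_on A (fun z => 'D_v Xf z) by move=> k; exact: (sXf k.+1).2.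
have sNf : smooth_on A Nf.
  (* The images of the two basis vectors under the differential of [X e] frame the tangent plane,
     and they depend smoothly on [(e, u)]. *)
  apply: (smooth_normal oA (sDX (d (delta_mx 0 0))) (sDX (d (delta_mx 0 1)))) => //.
  move=> z Az; split; [exact: NN|exact: XvN|exact: XvN|].
  rewrite -!dXf//; apply: cross_immersion.
  by case: z Az => e u [Ie Uu]; exact: (immX e Ie).2.
pose Xbar : E -> _ := congruence Xf Nf.
have sXbar : smooth_on A Xbar by exact: smooth_congruence.
split=> // e Ie.
have dXbar u v : U u ->
    'd (normal_congruence (X e) (N e)) u v = 'D_(d v) Xbar (e, u).
  by move=> Uu; have [_ <-] := diff_slice ((sXbar 1).1 (e, u) (conj Ie Uu)).
have varE u : variation_field (fun e => normal_congruence (X e) (N e)) e u =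
    'D_((1, 0) : E) Xbar (e, u).
  exact: (derive1_slice Xbar).
split.
- split=> [u Uu||u v w Uu].
  + exact: (congruence_TS2 Xf NN (conj Ie Uu : A (e, u))).
  + split=> [k|u Uu v w]; first exact: (Ck_on_slice openU Ie (sXbar k)).
    have Au : A (e, u) by [].
    move=> Evw; apply: ((immX e Ie).2 u Uu).
    apply: etrans (dXf _ v Au) _; apply: etrans _ (esym (dXf _ w Au)).
    apply: (derive_congruence_inj oA sXf sNf Au (XvN v _ Au) (XvN w _ Au)).
    by apply: etrans (esym (dXbar u v Uu)) _; apply: etrans _ (dXbar u w Uu).
  + have Au : A (e, u) by [].
    rewrite (dXbar u v Uu) (dXbar u w Uu).
    (* With both directions in the slice, the function being differentiated is <D_v X, N>, which is
       identically 0 on [A]. *)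
    apply: etrans (Omega_congruence_exact oA sXf sNf NN (d v) Au (XvN w)) _.
    exact: (derive_near_cst oA (d w) Au (XvN v)).
- split=> [k|u Uu].
    apply: (Ck_on_eq openU _ (Ck_on_slice openU Ie ((sXbar k.+1).2 ((1, 0) : E)))).
    by move=> u Uu; rewrite varE.
  by rewrite varE; exact: (congruence_tangent oA sXf sNf NN _ (conj Ie Uu : A (e, u))).
(* The normal speed is defined on all of [A], so its smoothness and its differential on a slice come
   by restriction. *)
- pose H (z : E) : R^o := dot ('D_((1, 0) : E) Xf z) (Nf z).
  have sH : smooth_on A H by move=> k; apply: Ck_on_dot => //; exact: sDX.
  exists (fun u => H (e, u)); split=> [k|u v Uu].
    exact: (Ck_on_slice openU Ie (sH k)).
  have [_ ->] := diff_slice ((sH 1).1 (e, u) (conj Ie Uu)).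
  rewrite varE dXbar//.
  exact: (Omega_congruence_exact oA sXf sNf NN _ (conj Ie Uu : A (e, u)) (XvN v)).
Qed.
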